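(* For any $\alpha,\beta\in[0,1]$ there exist arithmetic functions $f,g:\mathbb{N}\to\mathbb{C}$, not both identically zero, with $f(n)=\sum_{d\mid n}g(d)$ for all $n\in\mathbb{N}$, such that $\mathrm{supp}(f)$ has asymptotic density $\alpha$ and $\mathrm{supp}(g)$ has asymptotic density $\beta$. Moreover, $f$ and $g$ can be chosen to be multiplicative functions.
   Context: $\mathbb{N}$ denotes the positive integers. For an arithmetic function $h$, $\mathrm{supp}(h)=\{n\in\mathbb{N}: h(n)\neq 0\}$. The asymptotic density of $\mathcal{A}\subset\mathbb{N}$ is $\lim_{x\to\infty}\frac{1}{x}\#\{n\le x: n\in\mathcal{A}\}$. *)

(* Defs.v *)
From HB Require Import structures.
From mathcomp Require Import all_boot all_order all_algebra.
From mathcomp Require Import all_classical all_reals all_analysis.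
From mathcomp Require Import complex.

Set Implicit Arguments.
Unset Strict Implicit.
Unset Printing Implicit Defensive.

Import Order.TTheory GRing.Theory Num.Theory.
Import numFieldNormedType.Exports.

Local Open Scope classical_set_scope.
Local Open Scope ring_scope.
Local Open Scope complex_scope.

(* Arithmetic functions are functions on nat whose value at 0 is irrelevant:
   every notion below looks only at positive integers. *)

Definition identically_zero (R : realType) (h : nat -> R[i]) : Prop :=
  forall n : nat, (0 < n)%N -> h n = 0.

Definition supp (R : realType) (h : nat -> R[i]) : set nat :=
  [set n | (0 < n)%N /\ h n != 0].

Definition multiplicative_fun (R : realType) (h : nat -> R[i]) : Prop :=
  h 1%N = 1 /\
  forall m n : nat, (0 < m)%N -> (0 < n)%N -> coprime m n ->
    h (m * n)%N = h m * h n.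

(* #{1 <= n <= x : n \in A}; for x >= 0 the integers n <= x are those with
   n <= Num.truncn x. *)
Definition counting (R : realType) (A : set nat) (x : R) : nat :=
  (\sum_(1 <= n < (Num.truncn x).+1) (n \in A))%N.

Definition has_asymptotic_density (R : realType) (A : set nat) (a : R) : Prop :=
  (counting A x)%:R / x @[x --> +oo] --> a.

(* Main.v *)
(** Let [S] and [T] be disjoint sets of primes, and let [g] be the multiplicative
    function with [g (p ^ k) = 1] for [k <> 1], and [g p = -1], [0] or [1] according
    to whether [p] is in [S], in [T] or in neither. For [f = 1 * g] and [k >= 1] this
    gives [f (p ^ k) = k - 1], [k] or [k + 1]. Hence [f n = 0] exactly when some [p]
    in [S] divides [n] exactly once, and [g n = 0] exactly when some [p] in [T] does.

    The integers divisible exactly once by no prime of [S] have density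
    [\prod_(p in S) (1 - 1/p + 1/p^2)]: for finite [S] one adds the primes in
    increasing order, and the general case follows from a tail estimate. If the
    reciprocals of a set of primes have a divergent sum, then a greedy choice of [S]
    inside this set gives the product any prescribed value in [[0, 1]]. The primes of
    even rank and those of odd rank are two disjoint sets with this property, because
    the two sums differ by a bounded alternating sum. *)

Require Import Defs.
From HB Require Import structures.
From mathcomp Require Import all_boot all_order all_algebra.
From mathcomp Require Import all_classical all_reals all_analysis.
From mathcomp Require Import complex.
From mathcomp Require Import ring lra.

Set Implicit Arguments.
Unset Strict Implicit.
Unset Printing Implicit Defensive.

Import Order.TTheory GRing.Theory Num.Theory.
Import numFieldNormedType.Exports.

Local Open Scope ring_scope.
Local Open Scope complex_scope.

(** * Sums over multiples, and divisors of products and prime powers *)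

Lemma sum_multiples (V : nmodType) (F : nat -> V) (d X : nat) : (0 < d)%N ->
  \sum_(1 <= n < X.+1 | (d %| n)%N) F n =
  \sum_(1 <= m < (X %/ d).+1) F (d * m)%N.
Proof.
move=> d_gt0; elim: X => [|X IHX]; first by rewrite div0n !big_geq.
rewrite big_mkcond big_nat_recr //= -big_mkcond /= IHX divnS //.
case: ifPn => [dX|_]; last by rewrite add0n addr0.
rewrite add1n [RHS]big_nat_recr //=; congr (_ + F _).
by have := divnS X d_gt0; rewrite dX add1n => <-; rewrite mulnC divnK.
Qed.

(** The gcds of [d * e] with [m] and [n] return [d] and [e], which gives injectivity; the same gcds
    split any divisor of [m * n]. *)
Lemma divisorsM (m n : nat) : (0 < m)%N -> (0 < n)%N -> coprime m n ->
  perm_eq (divisors (m * n)) [seq (d * e)%N | d <- divisors m, e <- divisors n].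
Proof.
move=> m0 n0 co_mn.
have gcdl d e : (d %| m)%N -> (e %| n)%N -> gcdn (d * e) m = d.
  move=> dm en; rewrite gcdnC Gauss_gcdl; first by apply/gcdn_idPr.
  exact: coprime_dvdr en co_mn.
have gcdr d e : (d %| m)%N -> (e %| n)%N -> gcdn (d * e) n = e.
  move=> dm en; rewrite gcdnC Gauss_gcdr; first by apply/gcdn_idPr.
  by rewrite coprime_sym; apply: coprime_dvdl dm _.
apply: uniq_perm; first exact: divisors_uniq.
  apply: allpairs_uniq; try exact: divisors_uniq.
  move=> [d e] [d' e'] /allpairsP[[a b] /= [da eb [-> ->]]].
  move=> /allpairsP[[a' b'] /= [da' eb' [-> ->]]] /= E.
  rewrite -!dvdn_divisors // in da eb da' eb'.
  have <- : a = a' by rewrite -(gcdl a b) // E gcdl.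
  by have <- : b = b' by rewrite -(gcdr a b) // E gcdr.
move=> k; rewrite -dvdn_divisors ?muln_gt0 ?m0 //.
apply/idP/allpairsP => [kmn|[[d e] /= [dm en ->]]].
  exists (gcdn k m, gcdn k n); rewrite -!dvdn_divisors // !dvdn_gcdr; split=> //=.
  have k0 : (0 < k)%N by apply: dvdn_gt0 kmn; rewrite muln_gt0 m0.
  apply/eqP; rewrite eqn_dvd; apply/andP; split; last first.
    rewrite Gauss_dvd ?dvdn_gcdl //.
    apply: coprime_dvdl (dvdn_gcdr _ _) _.
    exact: coprime_dvdr (dvdn_gcdr _ _) co_mn.
  rewrite muln_gcdl !muln_gcdr !dvdn_gcd kmn.
  by rewrite !(dvdn_mulr _ (dvdnn k)) (dvdn_mull _ (dvdnn k)).
by rewrite dvdn_mul // dvdn_divisors.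
Qed.

Lemma divisors_primeX (p k : nat) : prime p ->
  perm_eq (divisors (p ^ k)) [seq (p ^ j)%N | j <- iota 0 k.+1].
Proof.
move=> p_pr; apply: uniq_perm; first exact: divisors_uniq.
  rewrite map_inj_in_uniq ?iota_uniq // => i j _ _ /eqP.
  by rewrite eqn_exp2l ?prime_gt1 // => /eqP.
move=> d; rewrite -dvdn_divisors ?expn_gt0 ?prime_gt0 //.
apply/(dvdn_pfactor _ _ p_pr)/mapP => [[j jk ->]|[j]].
  by exists j; rewrite ?mem_iota.
by rewrite mem_iota => jk ->; exists j.
Qed.

(** * Multiplicative functions and their values at prime powers *)

Section Multiplicative.
Variable (R : realType).
Implicit Types (g h : nat -> R[i]) (n : nat).

(** Only primes dividing [n] enter, so [c p k] prescribes the value at [p ^ k] for [k >= 1], and the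
    value at 1 is an empty product. *)
Definition mult_ext (c : nat -> nat -> R[i]) n : R[i] :=
  \prod_(p <- primes n) c p (logn p n).

Lemma mult_ext_multiplicative (c : nat -> nat -> R[i]) :
  multiplicative_fun (mult_ext c).
Proof.
split=> [|m n m0 n0 co_mn]; first by rewrite /mult_ext big_nil.
have dis p : p \in primes m -> p \notin primes n.
  move=> pm; move: co_mn; rewrite coprime_has_primes // => /hasPn H.
  by apply/negP => /H; rewrite pm.
have -> : mult_ext c (m * n) =
    \prod_(p <- primes m ++ primes n) c p (logn p (m * n)).
  apply: perm_big; apply: uniq_perm; first exact: primes_uniq.
    rewrite cat_uniq !primes_uniq andbT /=; apply/hasPn => p pn.
    by apply/negP => /dis; rewrite pn.
  by move=> p; rewrite mem_cat primesM.
rewrite big_cat /=; congr (_ * _); apply: eq_big_seq => p pP; rewrite lognM //.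
  by move: (dis p pP); rewrite -logn_gt0 lt0n negbK => /eqP ->; rewrite addn0.
by have := contraL (dis p) pP; rewrite -logn_gt0 lt0n negbK => /eqP ->.
Qed.

Lemma mult_ext_primeX (c : nat -> nat -> R[i]) (p k : nat) :
  prime p -> (0 < k)%N -> mult_ext c (p ^ k) = c p k.
Proof.
move=> p_pr k0; rewrite /mult_ext primesX // primes_prime // big_seq1.
by rewrite pfactorK.
Qed.

Lemma sum_divisors_multiplicative g : multiplicative_fun g ->
  multiplicative_fun (fun n => \sum_(d <- divisors n) g d).
Proof.
move=> [g1 gM]; split=> [|m n m0 n0 co_mn]; first by rewrite big_seq1.
rewrite (perm_big _ (divisorsM m0 n0 co_mn)) /= big_allpairs_dep /= mulr_suml.
apply: eq_big_seq => d; rewrite -dvdn_divisors // => dm; rewrite mulr_sumr.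
apply: eq_big_seq => e; rewrite -dvdn_divisors // => en.
apply: gM; rewrite ?(dvdn_gt0 _ dm) ?(dvdn_gt0 _ en) //.
exact: coprime_dvdl dm (coprime_dvdr en co_mn).
Qed.

(** Reduces the support to prime powers: [h n] is the product of its values at the exact prime
    powers in [n], and a field has no zero divisors. *)
Lemma multiplicative_neq0 h n : multiplicative_fun h -> (0 < n)%N ->
  (h n != 0) = all (fun p => h (p ^ logn p n)%N != 0) (primes n).
Proof.
move=> [h1 hM] n0.
(* The exponents stay those of [n] while the list of primes varies, so the induction can remove one
   prime at a time. *)
have H (s : seq nat) : uniq s -> all prime s -> h (\prod_(p <- s) p ^ logn p n)%N =
    \prod_(p <- s) h (p ^ logn p n)%N.
  elim: s => [|p s IHs] /=; first by rewrite !big_nil.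
  move=> /andP[ps us] /andP[pp prs]; rewrite !big_cons hM ?IHs //.
  - rewrite big_seq; apply: prodn_cond_gt0 => q /(allP prs) q_pr.
    by rewrite expn_gt0 prime_gt0.
  - rewrite big_seq; elim/big_ind: _ => [|a b ca cb|q qs].
    + by rewrite coprimen1.
    + by rewrite coprimeMr ca.
    + have q_pr := allP prs q qs; apply: coprimeXl; apply: coprimeXr.
      rewrite prime_coprime // dvdn_prime2 //.
      by apply: contra ps => /eqP ->.
have -> : h n = \prod_(p <- primes n) h (p ^ logn p n)%N.
  rewrite -H ?primes_uniq ?all_prime_primes //; congr h.
  by rewrite [LHS](prod_prime_decomp n0) prime_decompE big_map.
by rewrite prodf_seq_neq0; apply: eq_all.
Qed.

End Multiplicative.

(** * The convolution pair with prescribed supports *)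

Definition no_exact_divisor (S : pred nat) : set nat :=
  [set n | (0 < n)%N /\ forall p, S p -> logn p n != 1%N]%classic.

Lemma exists_convolution (R : realType) (S T : pred nat) :
  (forall p, S p -> prime p) -> (forall p, T p -> prime p) ->
  (forall p, S p -> ~~ T p) ->
  exists f g : nat -> R[i],
    [/\ forall n : nat, (0 < n)%N -> f n = \sum_(d <- divisors n) g d,
        supp f = no_exact_divisor S, supp g = no_exact_divisor T,
        multiplicative_fun f & multiplicative_fun g].
Proof.
move=> Spr Tpr ST.
pose e p : R[i] := if S p then -1 else if T p then 0 else 1.
pose c p k : R[i] := if k == 1%N then e p else 1.
pose g := mult_ext c; pose f n := \sum_(d <- divisors n) g d.
have gm : multiplicative_fun g by exact: mult_ext_multiplicative.
have fm : multiplicative_fun f by exact: sum_divisors_multiplicative.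
(* Both supports come from one criterion: among the prime powers, [h] must vanish exactly at the
   first powers of the primes in [U]. *)
have suppE (h : nat -> R[i]) (U : pred nat) : (forall p, U p -> prime p) ->
    multiplicative_fun h -> (forall p k, prime p -> (0 < k)%N ->
      (h (p ^ k)%N == 0) = U p && (k == 1%N)) -> supp h = no_exact_divisor U.
  move=> Upr hm h0; apply/seteqP; split=> n [n0 nh]; split=> //.
    move=> p Up; move: nh; rewrite multiplicative_neq0 // => /allP nh.
    apply/eqP => np1; have /nh : p \in primes n by rewrite -logn_gt0 np1.
    by rewrite np1 h0 ?Upr // Up.
  rewrite multiplicative_neq0 //; apply/allP => p pn.
  have p_pr : prime p by move: pn; rewrite mem_primes => /andP[].
  by rewrite h0 ?logn_gt0 //; apply/negP => /andP[/nh/negPf ->].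
exists f, g; split=> //; apply: suppE => // p k p_pr k0.
(* Along 1, p, ..., p^k the values of [g] are 1 and [e p], then [k - 1] ones. The sum vanishes only
   for [e p = -1] and [k = 1]. *)
- have -> : f (p ^ k)%N = k%:R + e p.
    rewrite /f (perm_big _ (divisors_primeX k p_pr)) /= big_cons big_map.
    have -> : g (p ^ 0)%N = 1 by case: gm.
    elim: k k0 => // -[_ _|k IHk _].
      by rewrite /= big_seq1 /g mult_ext_primeX.
    rewrite -[k.+2]addn1 iotaD big_cat /= addrA IHk // big_seq1 add1n.
    by rewrite /g mult_ext_primeX // /c /= natrD addrAC.
  rewrite /e; case: ifPn => Sp /=.
    by rewrite subr_eq0 (eqr_nat _ k 1).
  apply/negbTE; case: ifP => _; first by rewrite addr0 pnatr_eq0 -lt0n.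
  by rewrite natr1 pnatr_eq0.
- rewrite /g mult_ext_primeX // /c /e; case: (k == 1%N).
    rewrite andbT; case: ifPn => [/ST/negbTE ->|_].
      by rewrite oppr_eq0 oner_eq0.
    by case: ifP; rewrite ?eqxx ?oner_eq0.
  by rewrite andbF oner_eq0.
Qed.

(** * Reciprocals of the primes, split by the parity of their rank *)

Section PrimeSums.
Variable R : realType.
Implicit Types (n p N K X : nat).

(** A finite form of the Euler product bound, by induction on [N]. For [N] prime, the terms with [N]
    dividing [n] are at most 1/N times the whole sum, so allowing the prime [N] costs at most the
    factor 1/(1 - 1/N). *)
Lemma smooth_harmonic_le N X :
  (\sum_(1 <= n < X.+1 | all (fun p => (p < N)%N) (primes n)) n%:R^-1) *
  \prod_(0 <= p < N | prime p) (1 - p%:R^-1) <= 1 :> R.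
Proof.
pose smooth N n := all (fun p => (p < N)%N) (primes n).
pose H N X : R := \sum_(1 <= n < X.+1 | smooth N n) n%:R^-1.
rewrite -/(smooth N) -/(H N X); elim: N => [|N IHN].
  rewrite big_geq // mulr1 /H big_mkcond /=.
  case: X => [|X]; first by rewrite big_geq.
  rewrite big_ltn //= invr1 big_nat big1 ?addr0 // => n /andP[n1 _].
  rewrite /smooth; case: (primes n) (primes_eq0 n) => //.
  by rewrite eqxx ltnNge n1.
have [N_pr|N_npr] := boolP (prime N); last first.
  rewrite big_mkcond big_nat_recr //= -big_mkcond /= (negPf N_npr) mulr1.
  rewrite (_ : H N.+1 X = H N X) //; apply: eq_bigl => n; apply: eq_in_all => p.
  rewrite mem_primes ltnS => /andP[p_pr _]; rewrite leq_eqVlt.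
  by case: eqVneq N_npr => // <-; rewrite p_pr.
rewrite big_mkcond big_nat_recr //= -big_mkcond /= N_pr mulrC -mulrA mulrC.
apply: le_trans IHN; rewrite ler_wpM2r //.
  by apply: prodr_ge0 => p p_pr; rewrite subr_ge0 invf_le1 ?ltr0n ?ler1n prime_gt0.
rewrite mulrBl mul1r lerBlDr {1}/H (bigID (dvdn N)) /= addrC lerD //.
  rewrite le_eqVlt; apply/orP; left; apply/eqP.
  rewrite /H big_nat_cond [RHS]big_nat_cond; apply: eq_bigl => n.
  case: (boolP (0 < n < _)%N) => //= /andP[n0 _].
  have -> : (N %| n)%N = (N \in primes n) by rewrite mem_primes N_pr n0.
  apply/andP/allP => [[/allP sn Nn] p pn|sn].
    have := sn _ pn; rewrite ltnS leq_eqVlt => /orP[/eqP pN|//].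
    by rewrite -pN pn in Nn.
  split; first by apply/allP => p /sn /ltnW.
  by apply/negP => /sn; rewrite ltnn.
(* Writing n = N m, the range becomes m <= X/N, which is then enlarged to m <= X. *)
rewrite (eq_bigl (fun n => (N %| n) && smooth N.+1 n)%N).
  2: by move=> n; rewrite andbC.
rewrite big_mkcondr sum_multiples ?prime_gt0 // /H mulr_sumr.
rewrite [leRHS](big_cat_nat (n := (X %/ N).+1)) //=; last by rewrite ltnS leq_div.
rewrite ler_wpDr //.
  by apply: sumr_ge0 => n _; rewrite mulr_ge0 ?invr_ge0 ?ler0n.
rewrite [leRHS]big_mkcond /= !big_nat; apply: ler_sum => m /andP[m0 _].
case: ifPn => [/allP sNm|_].
  rewrite ifT ?natrM ?invfM //; apply/allP => p pm; apply: sNm.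
  by rewrite primesM // ?prime_gt0 // pm orbT.
by case: ifP => // _; rewrite mulr_ge0 ?invr_ge0 ?ler0n.
Qed.

Lemma harmonic_unbounded (M : R) : exists X, M < \sum_(1 <= n < X.+1) n%:R^-1.
Proof.
apply: contrapT => /forallNP bnd; apply: (@dvg_harmonic R).
apply: nondecreasing_is_cvgn.
  by apply: nondecreasing_series => n _ _; exact: harmonic_ge0.
exists M => _ [X _ <-]; rewrite leNgt; apply/negP => MX; apply: (bnd X).
by rewrite big_add1 /=.
Qed.

(** If the sum stayed below [M], the Euler product would be at least exp(-2M). Every n <= X has only
    primes below X + 1, so the harmonic sum would be at most exp(2M), against the choice of [X]. *)
Lemma sum_inv_primes_unbounded (M : R) :
  exists K, M < \sum_(0 <= p < K | prime p) p%:R^-1.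
Proof.
have [X MX] := harmonic_unbounded (expR (2 * M)).
exists X.+1; rewrite ltNge; apply/negP => leM.
have := smooth_harmonic_le X.+1 X.
have -> : \sum_(1 <= n < X.+1 | all (fun p => (p < X.+1)%N) (primes n)) n%:R^-1 =
    \sum_(1 <= n < X.+1) n%:R^-1 :> R.
  rewrite big_nat_cond [RHS]big_nat; apply: eq_bigl => n.
  case: (boolP (0 < n < X.+1)%N) => //= /andP[n0 nX].
  apply/allP => p; rewrite mem_primes => /and3P[_ _ /dvdn_leq pn].
  exact: leq_ltn_trans (pn n0) nX.
apply/negP; rewrite -ltNge.
set P := (X in _ * X).
have eP : expR (- (2 * M)) <= P.
  apply: (@le_trans _ _ (\prod_(0 <= p < X.+1 | prime p) expR (- (2 * p%:R^-1)))).
    by rewrite -expR_sum ler_expR sumrN -mulr_sumr lerN2 ler_pM2l.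
  apply: ler_prod => p p_pr; rewrite expR_ge0 /= expRN.
  have p_le : p%:R^-1 <= 2^-1 :> R.
    by rewrite lef_pV2 ?posrE ?ltr0n ?prime_gt0 // ler_nat prime_gt1.
  have p_ge : 0 <= p%:R^-1 :> R by rewrite invr_ge0 ler0n.
  (* 1 - t >= exp(-2t) on [0, 1/2], since exp(2t) >= 1 + 2t and (1 - t)(1 + 2t) >= 1 there. *)
  rewrite -div1r ler_pdivrMr ?expR_gt0 //.
  have := expR_ge1Dx (2 * p%:R^-1 : R).
  by move: p_le p_ge; set t := p%:R^-1; set e := expR _; nra.
rewrite -[ltLHS](mulfV (lt0r_neq0 (expR_gt0 (2 * M)))) -expRN.
apply: (@le_lt_trans _ _ (expR (2 * M) * P)); first by rewrite ler_wpM2l ?expR_ge0.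
by rewrite ltr_pM2r //; apply: lt_le_trans eP; exact: expR_gt0.
Qed.

Definition prime_rank p := count prime (iota 0 p).

Lemma prime_rankS p : prime_rank p.+1 = (prime_rank p + prime p)%N.
Proof. by rewrite /prime_rank -addn1 iotaD count_cat /= addn0 add0n. Qed.

(** This is an alternating sum with decreasing terms: the prime 2 has rank 0 and sign +, and the
    signs alternate along the primes. *)
Lemma alternating_sum_primes_bounded K :
  0 <= \sum_(0 <= p < K | prime p) (-1) ^+ odd (prime_rank p) * (p%:R^-1 : R) <= 1.
Proof.
pose D K : R := \sum_(0 <= p < K | prime p) (-1) ^+ odd (prime_rank p) * p%:R^-1.
rewrite -/(D K).
(* The strengthened bounds leave room 1/(k + 1) on the side towards which the next term moves,
   enough to absorb it even if k + 1 is prime. *)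
suff H k : if odd (prime_rank k.+1) then k.+1%:R^-1 <= D k.+1 <= 1
    else 0 <= D k.+1 <= 1 - k.+1%:R^-1.
  case: K => [|k]; first by rewrite /D big_geq // lexx ler01.
  have : 0 <= k.+1%:R^-1 :> R by [].
  have := H k; set v := k.+1%:R^-1.
  by case: ifP => _ /andP[lo hi] v0; apply/andP; split; lra.
elim: k => [|k].
  by rewrite /D big_mkcond big_nat1 /= invr1 subrr lexx.
rewrite (prime_rankS k.+1) oddD.
have -> : D k.+2 = D k.+1 +
    if prime k.+1 then (-1) ^+ odd (prime_rank k.+1) * k.+1%:R^-1 else 0.
  by rewrite /D big_mkcond big_nat_recr //= -big_mkcond.
have uv : k.+2%:R^-1 <= k.+1%:R^-1 :> R by rewrite lef_pV2 ?posrE // ler_nat.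
have u0 : 0 <= k.+2%:R^-1 :> R by [].
move: uv u0; set u := k.+2%:R^-1; set v := k.+1%:R^-1 => uv u0.
case: (odd (prime_rank k.+1)); case: (prime k.+1) => /= /andP[lo hi];
  rewrite ?expr1 ?expr0; apply/andP; split; lra.
Qed.

(** Each half is (A + D)/2 or (A - D)/2, for [A] the full sum and [D] the alternating one. As 0 <= D
    <= 1, it suffices that A > 2M + 1. *)
Lemma sum_inv_primes_parity_unbounded (b : bool) (M : R) : exists K,
  M < \sum_(0 <= p < K | prime p && (odd (prime_rank p) == b)) p%:R^-1.
Proof.
have [K MK] := sum_inv_primes_unbounded (2 * M + 1); exists K.
have := alternating_sum_primes_bounded K; move: MK.
set A := \sum_(_ <= _ < _ | _) _; set D := \sum_(_ <= _ < _ | _) _.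
move=> MK /andP[D0 D1].
have -> : \sum_(0 <= p < K | prime p && (odd (prime_rank p) == b)) p%:R^-1
   = (A + (-1) ^+ b * D) / 2.
  rewrite big_mkcondr mulr_sumr -big_split mulr_suml; apply: eq_bigr => p _ /=.
  by set t := p%:R^-1; case: odd; case: b; rewrite /= ?expr1 ?expr0; lra.
by case: b; rewrite ?expr1 ?expr0; lra.
Qed.

End PrimeSums.

(** * Greedy choice of primes with a prescribed product *)

Section Greedy.
Variable R : realType.
Implicit Types (n p N K X : nat) (S : pred nat).

(** The density of the integers divisible by [p] but not by p^2. *)
Definition exact_density p : R := p%:R^-1 - p%:R^-1 ^+ 2.

Definition sieve_density S N : R :=
  \prod_(0 <= p < N | S p) (1 - exact_density p).

Lemma inv_prime_bounds p : prime p -> 0 <= (p%:R^-1 : R) <= 2^-1.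
Proof.
move=> p_pr; rewrite invr_ge0 ler0n /=.
by rewrite lef_pV2 ?posrE ?ltr0n ?prime_gt0 // ler_nat prime_gt1.
Qed.

Lemma sieve_densityS S N : sieve_density S N.+1 =
  sieve_density S N * if S N then 1 - exact_density N else 1.
Proof. by rewrite /sieve_density big_mkcond big_nat_recr //= -big_mkcond. Qed.

Lemma sieve_density_gt0 S N : (forall p, S p -> prime p) -> 0 < sieve_density S N.
Proof.
move=> Spr; apply: prodr_gt0 => p /Spr/inv_prime_bounds /andP[].
by rewrite /exact_density; set t := p%:R^-1; nra.
Qed.

(* The factors satisfy (1 - d)(1 + d) <= 1, and d >= 1 / (2 p). *)
Lemma sieve_density_tail S N K : (forall p, S p -> prime p) -> (N <= K)%N ->
  sieve_density S K * (1 + (\sum_(N <= p < K | S p) p%:R^-1) / 2) <=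
  sieve_density S N.
Proof.
move=> Spr; elim: K => [|K IHK].
  by rewrite leqn0 => /eqP ->; rewrite big_geq // mul0r addr0 mulr1.
rewrite leq_eqVlt => /orP[/eqP <-|].
  by rewrite big_geq // mul0r addr0 mulr1.
rewrite ltnS => NK; apply: le_trans (IHK NK); rewrite sieve_densityS.
rewrite [in leLHS]big_mkcond big_nat_recr //= -big_mkcond /=.
rewrite -mulrA ler_wpM2l //; first exact/ltW/sieve_density_gt0.
have : 0 <= \sum_(N <= p < K | S p) p%:R^-1 :> R by apply: sumr_ge0.
set s := \sum_(_ <= _ < _ | _) _ => s0.
case: ifPn => [/Spr/inv_prime_bounds /andP[]|_]; last by rewrite mul1r addr0.
rewrite /exact_density; set t := K%:R^-1 => t0 t2.
(* With d = t - t^2 the claim reads (1 - d) t/2 <= d (1 + s/2), which follows from d >= t/2. The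
   products below are hints for [nra]. *)
have : 0 <= s * t by exact: mulr_ge0.
have : 0 <= s * t * (2^-1 - t) by rewrite mulr_ge0 ?mulr_ge0 ?subr_ge0.
have : 0 <= t * (2^-1 - t) by rewrite mulr_ge0 ?subr_ge0.
have : 0 <= t ^+ 3 by exact: exprn_ge0.
by rewrite !expr2; nra.
Qed.

(** Only the running product is recorded; the set of accepted candidates is read off from it
    afterwards. *)
Fixpoint greedy (c : pred nat) (alpha : R) N : R :=
  if N is N'.+1 then
    let P := greedy c alpha N' in
    if c N' && (alpha <= P * (1 - exact_density N'))
    then P * (1 - exact_density N') else P
  else 1.

(** The product never drops below [alpha] by construction. If it stayed above some L > alpha, all
    large candidates would be accepted, and their divergent sum would force it below [L]. *)
Lemma exists_sieve_density (c : pred nat) (alpha : R) :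
  (forall p, c p -> prime p) ->
  (forall M : R, exists K, M < \sum_(0 <= p < K | c p) p%:R^-1) ->
  0 <= alpha <= 1 ->
  exists S, [/\ forall p, S p -> c p, forall N, alpha <= sieve_density S N &
    forall L, alpha < L -> exists N, sieve_density S N < L].
Proof.
move=> cpr c_unb /andP[alpha0 alpha1].
pose S p := c p && (alpha <= greedy c alpha p * (1 - exact_density p)).
have Spr p : S p -> prime p by move=> /andP[/cpr].
have SE N : sieve_density S N = greedy c alpha N.
  elim: N => [|N IHN]; first by rewrite /sieve_density big_geq.
  by rewrite sieve_densityS IHN /= /S; case: ifP => _ //; rewrite mulr1.
have S_ge N : alpha <= sieve_density S N.
  rewrite SE; elim: N => //= N IHN; by case: ifP => // /andP[].
exists S; split => // [p /andP[]//|L aL].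
apply: contrapT => /forallNP PL.
have {}PL N : L <= sieve_density S N by rewrite leNgt; apply/negP/PL.
have L0 : 0 < L by exact: le_lt_trans aL.
(* from [N] on every candidate is accepted *)
have [N N_small] : exists N, forall p, (N <= p)%N -> c p -> p%:R^-1 <= 1 - alpha / L.
  have e0 : 0 < 1 - alpha / L by rewrite subr_gt0 ltr_pdivrMr // mul1r.
  exists (Num.truncn (1 - alpha / L)^-1).+1 => p Np /cpr/prime_gt0 p0.
  rewrite -[leRHS]invrK lef_pV2 ?posrE ?invr_gt0 ?ltr0n //.
  by apply: ltW; apply: lt_le_trans (truncnS_gt _) _; rewrite ler_nat.
(* The current product is at least [L] and the new factor at least alpha/L, so accepting [p] keeps
   the product at least [alpha]. *)
have cS p : (N <= p)%N -> c p = S p.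
  move=> Np; rewrite /S; case: (boolP (c p)) => //= cp; apply/esym.
  have ap := N_small p Np cp; rewrite -SE.
  have /andP[t0 t2] := inv_prime_bounds (cpr p cp).
  have d1 : alpha / L <= 1 - exact_density p.
    by rewrite /exact_density; move: t0 t2 ap; set t := p%:R^-1; nra.
  rewrite -[leLHS](mulfVK (lt0r_neq0 L0)) mulrC.
  by apply: ler_pM => //; [exact: ltW | apply: divr_ge0 => //; exact: ltW].
(* The threshold makes the sum s over [N, K) exceed 2 P(N)/L, where P is the sieve product; then
   P(K)(1 + s/2) > P(N), against the tail estimate. *)
have [K] := c_unb (\sum_(0 <= p < N | c p) p%:R^-1 + 2 * (sieve_density S N / L)).
have [KN|NK] := leqP K N.
  rewrite ltNge => /negP; apply.
  rewrite [X in _ <= X + _](big_cat_nat (n := K)) //= -addrA lerDl.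
  rewrite addr_ge0 ?sumr_ge0 //.
  by rewrite mulr_ge0 // divr_ge0 ?(ltW (sieve_density_gt0 _ _)) // ltW.
rewrite [X in _ < X](big_cat_nat (n := N)) //= 1?ltnW // ltrD2l.
rewrite big_nat_cond (eq_bigl (fun p => (N <= p < K)%N && S p)); last first.
  by move=> p; case: (boolP (N <= p < K)%N) => //= /andP[/cS].
rewrite -big_nat_cond => bad.
have := sieve_density_tail Spr (ltnW NK).
move: bad; set s := \sum_(_ <= _ < _ | _) _; rewrite -ltr_pdivlMl // => bad.
apply/negP; rewrite -ltNge.
have : sieve_density S N < L * (2^-1 * s) by rewrite -ltr_pdivrMl // mulrC.
have := PL K; set P := sieve_density S K => LP h.
have s0 : 0 <= s by apply: sumr_ge0.
by nra.
Qed.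

End Greedy.

(** * Densities of the sieved sets, at finite stages and in the limit *)

Section Density.
Variable R : realType.
Implicit Types (n p N K X : nat) (S : pred nat) (b : pred nat) (x : R).

Definition sieve S N : pred nat :=
  fun n => all (fun p => S p ==> (logn p n != 1%N)) (iota 0 N).

Definition count_upto b X : nat := (\sum_(1 <= n < X.+1) b n)%N.

Lemma sieveS S N n :
  sieve S N.+1 n = sieve S N n && (S N ==> (logn N n != 1%N)).
Proof. by rewrite /sieve -[N.+1]addn1 iotaD all_cat /= andbT. Qed.

(** Stage [N] tests only primes below [N], whose exponents a power of the prime [N] leaves
    unchanged. *)
Lemma sieve_mulX S N k n : (forall p, S p -> prime p) -> prime N -> (0 < n)%N ->
  sieve S N (N ^ k * n)%N = sieve S N n.
Proof.
move=> Spr N_pr n0; apply: eq_in_all => p; rewrite mem_iota add0n /= => pN.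
case: (boolP (S p)) => //= Sp.
rewrite lognM ?expn_gt0 ?(prime_gt0 N_pr) // lognX logn_prime //.
by rewrite (ltn_eqF pN) muln0.
Qed.

(* Multiples of [N] in the sieve correspond to elements of the sieve up to
   [X / N], whence the density factor [1 - 1/N + 1/N^2]. *)
Lemma count_sieveS S N X : (forall p, S p -> prime p) -> S N ->
  (count_upto (sieve S N.+1) X + count_upto (sieve S N) (X %/ N) =
   count_upto (sieve S N) X + count_upto (sieve S N) (X %/ N ^ 2))%N.
Proof.
move=> Spr SN; have N_pr := Spr N SN.
have mulE k : count_upto (sieve S N) (X %/ N ^ k) =
    (\sum_(1 <= n < X.+1) (N ^ k %| n)%N * sieve S N n)%N.
  rewrite /count_upto; under [RHS]eq_bigr do rewrite mulnbl.
  rewrite -[RHS]big_mkcond; apply/esym.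
  have Nk0 : (0 < N ^ k)%N by rewrite expn_gt0 prime_gt0.
  apply: etrans (sum_multiples (fun n => sieve S N n : nat) X Nk0) _.
  rewrite -[LHS]/(\sum_(1 <= m < (X %/ N ^ k).+1) sieve S N (N ^ k * m))%N.
  rewrite !big_nat; apply: eq_bigr => m /andP[m0 _].
  by rewrite sieve_mulX.
have -> : (X %/ N = X %/ N ^ 1)%N by rewrite expn1.
rewrite !mulE -!big_split !big_nat; apply: eq_bigr => n /andP[n0 _] /=.
(* For [n] in the sieve this is [v <> 1] + [v >= 1] = 1 + [v >= 2], where v is the exponent of [N];
   check v = 0, v = 1 and v >= 2. *)
rewrite sieveS SN /= !pfactor_dvdn //.
by case: (sieve S N n); case: (logn N n) => [|[|k]].
Qed.

Lemma truncn_div x p : 0 <= x -> (0 < p)%N ->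
  Num.truncn (x / p%:R) = (Num.truncn x %/ p)%N.
Proof.
move=> x0 p0; have p0' : 0 < p%:R :> R by rewrite ltr0n.
apply: truncn_def; have /andP[lo hi] := truncn_itv x0.
rewrite ler_pdivlMr // ltr_pdivrMr // -!natrM; apply/andP; split.
  by apply: le_trans lo; rewrite ler_nat leq_divM.
by apply: lt_le_trans hi _; rewrite ler_nat ltn_ceil.
Qed.

(** Dividing [count_sieveS] by [x] expresses the new ratio as F(x) - F(x/N)/N + F(x/N^2)/N^2, with F
    the ratio of the previous stage, and x/N^k still tends to infinity. *)
Lemma sieve_cvg S N : (forall p, S p -> prime p) ->
  ((count_upto (sieve S N) (Num.truncn x))%:R / x @[x --> +oo] -->
   sieve_density R S N)%classic.
Proof.
move=> Spr; elim: N => [|N IHN].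
  rewrite /sieve_density big_geq //.
  apply/cvgrPdist_le => e e0; near=> x.
  have x0 : 0 < x by near: x; exact: nbhs_pinfty_gt.
  have ex : e^-1 <= x by near: x; apply: nbhs_pinfty_ge; exact: num_real.
  have -> : count_upto (sieve S 0) (Num.truncn x) = Num.truncn x.
    by rewrite /count_upto sum_nat_const_nat muln1 subn1.
  have /andP[lo hi] := truncn_itv (ltW x0).
  rewrite -[X in `|X - _|](mulfV (lt0r_neq0 x0)) -mulrBl normrM normfV.
  rewrite (gtr0_norm x0) ler_pdivrMr // ger0_norm ?subr_ge0 //.
  apply: (@le_trans _ _ 1); last by rewrite -ler_pdivrMl // mulr1.
  by rewrite lerBlDr addrC natr1 ltW.
rewrite sieve_densityS; case: ifPn => [SN|/negbTE SN]; last first.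
  rewrite mulr1; apply: cvg_trans IHN; apply: near_eq_cvg.
  apply: nearW => x; congr (_%:R / _).
  by apply: eq_bigr => n _; rewrite sieveS SN andbT.
have N0 : (0 < N)%N by rewrite prime_gt0 // Spr.
pose F x : R := (count_upto (sieve S N) (Num.truncn x))%:R / x.
have scale k : (F (x / (N ^ k)%:R) / (N ^ k)%:R @[x --> +oo] -->
    sieve_density R S N / (N ^ k)%:R)%classic.
  apply: cvgM; last exact: cvg_cst.
  have : ((x / (N ^ k)%:R) @[x --> +oo] --> (+oo : set_system R))%classic.
    by apply: gt0_cvgMly => //; rewrite invr_gt0 ltr0n expn_gt0 N0.
  by move/cvg_comp; apply.
have := cvgD (cvgB IHN (scale 1%N)) (scale 2%N).
have -> : sieve_density R S N - sieve_density R S N / (N ^ 1)%:R +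
    sieve_density R S N / (N ^ 2)%:R = sieve_density R S N * (1 - exact_density R N).
  by rewrite /exact_density expn1 natrX -exprVn; ring.
move=> lim; apply: cvg_trans (lim _ _); apply: near_eq_cvg; near=> x.
have x0 : 0 < x by near: x; exact: nbhs_pinfty_gt.
rewrite !fctE /F !truncn_div ?ltW // ?expn_gt0 ?N0 //.
have := count_sieveS (Num.truncn x) Spr SN.
move=> /(congr1 (fun k => k%:R : R)); rewrite expn1 !natrD => /(canRL (addrK _)) ->.
have N0' : N%:R != 0 :> R by rewrite pnatr_eq0 -lt0n.
rewrite natrX; field.
by rewrite N0' lt0r_neq0.
Unshelve. all: by end_near.
Qed.
Lemma counting_le S N x : (forall p, S p -> prime p) ->
  (Defs.counting (no_exact_divisor S) x <= count_upto (sieve S N) (Num.truncn x))%N.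
Proof.
move=> Spr; rewrite /Defs.counting /count_upto; apply: leq_sum => n _.
case: (boolP (n \in _)) => // /set_mem[n0 nS].
by rewrite lt0b; apply/allP => p _; apply/implyP/nS.
Qed.

(** An integer that survives stage [N] but lies outside the set is a multiple of some p in [S] with
    p >= N; there are X/p multiples of each such p, rounded down. *)
Lemma count_sieve_le S N x : (forall p, S p -> prime p) ->
  (count_upto (sieve S N) (Num.truncn x) <=
   Defs.counting (no_exact_divisor S) x +
   \sum_(N <= p < (Num.truncn x).+1 | S p) Num.truncn x %/ p)%N.
Proof.
move=> Spr; rewrite /Defs.counting /count_upto; set X := Num.truncn x.
have mulE p : S p -> (X %/ p = \sum_(1 <= n < X.+1) (p %| n))%N.
  move=> Sp; apply/esym; rewrite -big_mkcond.
  apply: etrans (sum_multiples (fun=> 1%N) X (prime_gt0 (Spr p Sp))) _.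
  rewrite -[LHS]/(\sum_(1 <= m < (X %/ p).+1) 1)%N.
  by rewrite sum_nat_const_nat muln1 subn1.
rewrite (eq_bigr _ mulE) exchange_big /= -big_split /=.
rewrite !big_nat; apply: leq_sum => n /andP[n0 nX].
case: (boolP (sieve S N n)) => // /allP nS.
case: (boolP (n \in _)) => //= /negP nA.
have [p Sp np] : exists2 p, S p & logn p n = 1%N.
  apply: contrapT => no; apply: nA; apply: mem_set; split => // p Sp.
  by apply/negP => /eqP np; apply: no; exists p.
have pn : (p %| n)%N.
  by have := pfactor_dvdn 1 (Spr p Sp) n0; rewrite expn1 np => ->.
have Np : (N <= p)%N.
  rewrite leqNgt; apply/negP => pN; have := nS p.
  by rewrite mem_iota add0n Sp np => /(_ pN).
(* Isolating the summand at [p] already gives the required 1. *)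
rewrite add0n (big_cat_nat (n := p)) //=; last first.
  by apply: leq_trans nX; apply: ltnW; rewrite ltnS dvdn_leq.
rewrite [X in (_ + X)%N]big_mkcond big_ltn ?Sp ?pn; last first.
  by apply: leq_ltn_trans nX; rewrite dvdn_leq.
by rewrite addnCA leq_addr.
Qed.

(** Rearranges [sieve_density_tail] after bounding the product at [K] below by [alpha]. The bound
    becomes small once the product at [N] is close to [alpha]. *)
Lemma sum_inv_tail_le S (alpha : R) N K : (forall p, S p -> prime p) ->
  0 < alpha -> (forall N, alpha <= sieve_density R S N) ->
  \sum_(N <= p < K | S p) p%:R^-1 <= 2 * (sieve_density R S N / alpha - 1).
Proof.
move=> Spr a0 aS; have [KN|/ltnW NK] := leqP K N.
  by rewrite big_geq // mulr_ge0 // subr_ge0 ler_pdivlMr // mul1r.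
rewrite -ler_pdivrMl // lerBrDr ler_pdivlMr // mulrC [_^-1 * _]mulrC.
apply: le_trans (sieve_density_tail R Spr NK).
rewrite [_ / 2 + 1]addrC ler_wpM2r // addr_ge0 // divr_ge0 ?sumr_ge0 //.
Qed.

(** Any stage close to [alpha] bounds the count from above. From below, the loss beyond that stage
    is controlled by the tail sum if alpha > 0, and nothing is to be shown if alpha = 0. *)
Lemma no_exact_divisor_density S (alpha : R) :
  (forall p, S p -> prime p) -> 0 <= alpha ->
  (forall N, alpha <= sieve_density R S N) ->
  (forall L, alpha < L -> exists N, sieve_density R S N < L) ->
  has_asymptotic_density (no_exact_divisor S) alpha.
Proof.
move=> Spr alpha0 aS Sa; apply/cvgrPdist_le => e e0.
have a1 : alpha <= 1 by have := aS 0%N; rewrite /sieve_density big_geq.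
have [N [SN_e tail_e]] : exists N, sieve_density R S N <= alpha + e / 2 /\
    (0 < alpha -> 2 * (sieve_density R S N / alpha - 1) <= e / 2).
  have [a0|a0] := ltP 0 alpha.
    (* The margin [alpha * (e / 4)] makes the tail bound at most e/2; as alpha <= 1, it is itself
       below e/2. *)
    have [|N SN] := Sa (alpha + alpha * (e / 4)).
      by rewrite ltrDl mulr_gt0 // divr_gt0.
    exists N; split=> [|_].
      by apply: ltW; apply: (lt_le_trans SN); nra.
    rewrite -ler_pdivlMl // lerBlDr ler_pdivrMr //.
    by apply: (le_trans (ltW SN)); nra.
  have [|N SN] := Sa (alpha + e / 2); first by rewrite ltrDl divr_gt0.
  by exists N; split; first exact: ltW.
have /cvgrPdist_le /(_ (e / 2)) := @sieve_cvg S N Spr.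
rewrite divr_gt0 // => /(_ isT) lim; near=> x.
have x0 : 0 < x by near: x; exact: nbhs_pinfty_gt.
have : `|sieve_density R S N -
         (count_upto (sieve S N) (Num.truncn x))%:R / x| <= e / 2.
  by near: x.
have up : (Defs.counting (no_exact_divisor S) x)%:R / x <=
    (count_upto (sieve S N) (Num.truncn x))%:R / x.
  by rewrite ler_pM2r ?invr_gt0 // ler_nat counting_le.
rewrite !ler_distl => /andP[Slo Shi].
have A0 : 0 <= (Defs.counting (no_exact_divisor S) x)%:R / x.
  by rewrite divr_ge0 // ltW.
apply/andP; split; last first.
  have [a0|a0] := ltP 0 alpha; last first.
    by move: A0; set A := _ / x => A0; lra.
  have lo : (count_upto (sieve S N) (Num.truncn x))%:R / x <=
      (Defs.counting (no_exact_divisor S) x)%:R / x + e / 2.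
    apply: le_trans (lerD (lexx _) (tail_e a0)).
    apply: le_trans (lerD (lexx _) (sum_inv_tail_le N (Num.truncn x).+1 Spr a0 aS)).
    rewrite ler_pdivrMr // mulrDl divfK ?lt0r_neq0 //.
    have := count_sieve_le N x Spr; rewrite -(ler_nat R) natrD => /le_trans; apply.
    rewrite lerD2l natr_sum mulr_suml; apply: ler_sum => p Sp.
    have p0 : 0 < p%:R :> R by rewrite ltr0n prime_gt0 // Spr.
    rewrite mulrC ler_pdivlMr // -natrM.
    have /andP[xX _] := truncn_itv (ltW x0).
    by apply: le_trans xX; rewrite ler_nat leq_divM.
  by have := aS N; lra.
lra.
Unshelve. all: by end_near.
Qed.

End Density.

(** * Combination of the two parity classes, odd ranks for [f] and even ranks for [g] *)

Theorem theorem1p3 (R : realType) (alpha beta : R)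
  (halpha : 0 <= alpha <= 1) (hbeta : 0 <= beta <= 1) :
  exists f g : nat -> R[i],
    [/\ ~ (identically_zero f /\ identically_zero g),
        forall n : nat, (0 < n)%N -> f n = \sum_(d <- divisors n) g d,
        has_asymptotic_density (supp f) alpha,
        has_asymptotic_density (supp g) beta
      & multiplicative_fun f /\ multiplicative_fun g].
Proof.
pose c b : pred nat := fun p => prime p && (odd (prime_rank p) == b).
have c_pr b p : c b p -> prime p by move=> /andP[].
have [S [Sc S_ge S_lt]] := exists_sieve_density (c_pr true)
  (sum_inv_primes_parity_unbounded true) halpha.
have [T [Tc T_ge T_lt]] := exists_sieve_density (c_pr false)
  (sum_inv_primes_parity_unbounded false) hbeta.
have Spr p : S p -> prime p by move=> /Sc /c_pr.
have Tpr p : T p -> prime p by move=> /Tc /c_pr.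
have ST p : S p -> ~~ T p.
  move=> /Sc /andP[_ /eqP p_odd]; apply/negP => /Tc /andP[_].
  by rewrite p_odd.
have [f [g [fE fS gT fm gm]]] := exists_convolution R Spr Tpr ST.
have /andP[alpha0 _] := halpha; have /andP[beta0 _] := hbeta.
exists f, g; split=> //.
- by move=> [/(_ 1%N isT)]; case: fm => -> _ /eqP; rewrite oner_eq0.
- by rewrite fS; exact: no_exact_divisor_density.
- by rewrite gT; exact: no_exact_divisor_density.
Qed.
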